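(* Let $\omega$ be a non-principal ultrafilter on $\mathbb{N}$, let $\{n_k\}_k$ be a sequence of positive integers with $\lim_k n_k=\infty$, and let $G=\Pi_{k\to\omega}S_{n_k}$ be the associated universal sofic group. Then every automorphism of $G$ is class preserving; that is, for every group automorphism $\Phi$ of $G$ and every $p\in G$, the element $\Phi(p)$ is conjugate to $p$ in $G$.
   Context: $S_n$ is the symmetric group on $\{1,\dots,n\}$, with normalized Hamming distance $d_{Hamm}(p,q)=\frac1n|\{a:p(a)\neq q(a)\}|$. For a non-principal ultrafilter $\omega$ on $\mathbb{N}$ and a sequence of positive integers $n_k\to\infty$, let $\mathcal{N}_\omega=\{(p_k)_k\in\Pi_kS_{n_k}:\lim_{k\to\omega}d_{Hamm}(p_k,Id)=0\}$, a normal subgroup of the Cartesian product $\Pi_kS_{n_k}$. The universal sofic group is the quotient $\Pi_{k\to\omega}S_{n_k}=\Pi_kS_{n_k}/\mathcal{N}_\omega$. Automorphisms are automorphisms of the abstract group. *)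

(* Defs.v *)
From HB Require Import structures.
From mathcomp Require Import all_boot all_order all_algebra all_fingroup.
From mathcomp Require Import all_classical all_reals all_analysis.
Import Order.TTheory GRing.Theory Num.Theory.
Import numFieldNormedType.Exports.

Set Implicit Arguments.
Unset Strict Implicit.
Unset Printing Implicit Defensive.

Local Open Scope classical_set_scope.
Local Open Scope quotient_scope.
Local Open Scope group_scope.

Definition prodg (I : Type) (T : I -> groupType) : Type := forall i, T i.

Section ProductGroup.
Variables (I : Type) (T : I -> groupType).
Implicit Types x y z : prodg T.

HB.instance Definition _ := Choice.copy (prodg T) (forall i, T i).

Let one : prodg T := fun=> 1.
Let mul x y : prodg T := fun i => x i * y i.
Let inv x : prodg T := fun i => (x i)^-1.

Let mulA : associative mul.
Proof. by move=> x y z; apply: functional_extensionality_dep => i; apply: mulgA. Qed.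
Let mul1 : left_id one mul.
Proof. by move=> x; apply: functional_extensionality_dep => i; apply: mul1g. Qed.
Let mulr1 : right_id one mul.
Proof. by move=> x; apply: functional_extensionality_dep => i; apply: mulg1. Qed.
Let mulV : left_inverse one inv mul.
Proof. by move=> x; apply: functional_extensionality_dep => i; apply: mulVg. Qed.
Let mulrV : right_inverse one inv mul.
Proof. by move=> x; apply: functional_extensionality_dep => i; apply: mulgV. Qed.

HB.instance Definition _ := isGroup.Build (prodg T) mulA mul1 mulr1 mulV mulrV.

End ProductGroup.

Record normal_subgroup (G : groupType) := NormalSubgroup {
  nsg_set :> G -> Prop;
  nsg1 : nsg_set 1;
  nsgM : forall x y, nsg_set x -> nsg_set y -> nsg_set (x * y);
  nsgV : forall x, nsg_set x -> nsg_set x^-1;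
  nsgJ : forall x y, nsg_set x -> nsg_set (x ^ y)
}.

Section QuotientGroup.
Variables (G : groupType) (N : normal_subgroup G).

Definition coset_rel (x y : G) : bool := `[< N (x^-1 * y) >].

Lemma coset_rel_refl : reflexive coset_rel.
Proof. by move=> x; apply/asboolP; rewrite mulVg; exact: nsg1. Qed.

Lemma coset_rel_sym : symmetric coset_rel.
Proof.
suff H x y : coset_rel x y -> coset_rel y x by move=> x y; apply/idP/idP; exact: H.
move=> /asboolP /nsgV; rewrite invgM invgK => ?; exact/asboolP.
Qed.

Lemma coset_rel_trans : transitive coset_rel.
Proof.
move=> y x z /asboolP xy /asboolP yz; apply/asboolP.
by have := nsgM xy yz; rewrite mulgA -(mulgA x^-1) mulgV mulg1.
Qed.

Canonical coset_equiv :=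
  EquivRel coset_rel coset_rel_refl coset_rel_sym coset_rel_trans.

Definition quotg : Type := {eq_quot coset_equiv}.

HB.instance Definition _ := Choice.on quotg.
HB.instance Definition _ := EqQuotient.on quotg.

Local Notation cl := (\pi_quotg : G -> quotg).

(* Otherwise shadowed by fingroup.repr. *)
Local Notation repr := generic_quotient.repr.

Lemma quotgP x y : reflect (N (x^-1 * y)) (cl x == cl y).
Proof. by rewrite eqmodE; exact: asboolP. Qed.

Definition quotg_one : quotg := cl 1.
Definition quotg_mul (a b : quotg) : quotg := cl (repr a * repr b).
Definition quotg_inv (a : quotg) : quotg := cl (repr a)^-1.

Lemma pi_mulg x y : cl (x * y) = quotg_mul (cl x) (cl y).
Proof.
have /eqP/quotgP hx : cl (repr (cl x)) = cl x by rewrite reprK.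
have /eqP/quotgP hy : cl (repr (cl y)) = cl y by rewrite reprK.
apply/esym/eqP/quotgP; move: (repr (cl x)) (repr (cl y)) hx hy => x' y' hx hy.
have := nsgM (nsgJ y' hx) hy.
by rewrite conjgE invgM !mulgA mulgK.
Qed.

Lemma pi_invg x : cl x^-1 = quotg_inv (cl x).
Proof.
have /eqP/quotgP/nsgV/(nsgJ x^-1) : cl x = cl (repr (cl x)) by rewrite reprK.
rewrite conjgE !invgM !invgK !mulgA mulgK => hx.
by apply/eqP/quotgP; rewrite invgK.
Qed.

Let mulA : associative quotg_mul.
Proof.
move=> a b c; rewrite -[a]reprK -[b]reprK -[c]reprK.
move: (repr a) (repr b) (repr c) => x y z.
by rewrite -(pi_mulg y z) -(pi_mulg x y) -!pi_mulg mulgA.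
Qed.

Let mul1 : left_id quotg_one quotg_mul.
Proof. by move=> a; rewrite -[a]reprK /quotg_one -pi_mulg mul1g. Qed.

Let mulr1 : right_id quotg_one quotg_mul.
Proof. by move=> a; rewrite -[a]reprK /quotg_one -pi_mulg mulg1. Qed.

Let mulV : left_inverse quotg_one quotg_inv quotg_mul.
Proof. by move=> a; rewrite -[a]reprK /quotg_one -pi_invg -pi_mulg mulVg. Qed.

Let mulrV : right_inverse quotg_one quotg_inv quotg_mul.
Proof. by move=> a; rewrite -[a]reprK /quotg_one -pi_invg -pi_mulg mulgV. Qed.

HB.instance Definition _ := isGroup.Build quotg mulA mul1 mulr1 mulV mulrV.

End QuotientGroup.

Section UniversalSofic.
Variable R : realType.

(* 'S_n acts on {0, .., n-1}, the set {1, .., n} shifted by one. *)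
Definition dHamm (n : nat) (p q : 'S_n) : R :=
  (#|[set a | p a != q a]%SET|%:R / n%:R)%R.

Lemma dHamm_ge0 n (p q : 'S_n) : (0 <= dHamm p q)%R.
Proof. by rewrite divr_ge0. Qed.

Lemma dHammM n (p q : 'S_n) : (dHamm (p * q) 1 <= dHamm p 1 + dHamm q 1)%R.
Proof.
rewrite /dHamm -mulrDl ler_wpM2r ?invr_ge0// -natrD ler_nat.
have le_pq : ([set a | (p * q)%g a != (1%g : 'S_n) a] \subset
    [set a | p a != (1%g : 'S_n) a] :|: p @^-1: [set a | q a != (1%g : 'S_n) a])%SET.
  apply/fintype.subsetP => a; rewrite !inE !perm1 permM.
  by case: (eqVneq (p a) a) => //= ->.
apply: (leq_trans (subset_leq_card le_pq)).
apply: (leq_trans (leq_card_setU _ _)).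
by rewrite leq_add2l card_preimset //; exact: perm_inj.
Qed.

Lemma dHammV n (p : 'S_n) : dHamm p^-1 1 = dHamm p 1.
Proof.
rewrite /dHamm; congr (_%:R / _)%R; apply: eq_card => a.
by rewrite !inE !perm1 (can2_eq (permKV p) (permK p)) eq_sym.
Qed.

Lemma dHammJ n (p q : 'S_n) : dHamm (p ^ q) 1 = dHamm p 1.
Proof.
rewrite /dHamm; congr (_%:R / _)%R.
rewrite -[RHS](card_imset _ (@perm_inj _ q)); apply: eq_card => a.
rewrite -[a](permKV q) mem_imset; last exact: perm_inj.
by rewrite !inE !perm1 permJ (inj_eq perm_inj).
Qed.

Variables (omega : set_system nat) (n : nat -> nat).

Definition ultra_null (p : prodg (fun k => 'S_(n k))) : Prop :=
  (fun k => dHamm (p k) 1) @ omega --> (0 : R)%R.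

Context {omegaF : Filter omega}.

Let ultra_null1 : ultra_null 1.
Proof.
apply: cvg_near_cst; apply: nearW => k; apply/eqP.
rewrite /dHamm (_ : [set _ | _]%SET = finset.set0) ?cards0 ?mul0r//.
by apply/setP => a; rewrite !inE eqxx.
Qed.

Let ultra_nullM p q : ultra_null p -> ultra_null q -> ultra_null (p * q).
Proof.
move=> p0 q0; have /(_ omegaF) pq0 := cvgD p0 q0; rewrite addr0 in pq0.
apply: (squeeze_cvgr (f := fun=> 0%R) _ _ pq0); last exact: cvg_cst.
by apply: nearW => k; rewrite dHamm_ge0; apply: dHammM.
Qed.

Let ultra_nullV p : ultra_null p -> ultra_null p^-1.
Proof.
rewrite /ultra_null => p0.
rewrite (_ : (fun k => _) = fun k => dHamm (p k) 1) //.
by apply/funext => k; exact: dHammV.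
Qed.

Let ultra_nullJ p q : ultra_null p -> ultra_null (p ^ q).
Proof.
rewrite /ultra_null => p0.
rewrite (_ : (fun k => _) = fun k => dHamm (p k) 1) //.
by apply/funext => k; exact: (dHammJ (p k) (q k)).
Qed.

Definition N_omega : normal_subgroup (prodg (fun k => 'S_(n k))) :=
  NormalSubgroup ultra_null1 ultra_nullM ultra_nullV ultra_nullJ.

Definition universal_sofic : groupType := quotg N_omega.

End UniversalSofic.

Arguments N_omega R omega n {omegaF}.
Arguments universal_sofic R omega n {omegaF}.

(* Main.v *)
Require Import Defs.
From mathcomp Require Import all_boot all_order all_algebra all_fingroup.
From mathcomp Require Import zify lra.

(** Let len a be the ultralimit of the distances of the coordinates of a to the
    identity, i.e. the measure of the support of a.

    Conjugacy is detected by len: a and b are conjugate as soon as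
    len (a ^+ j) = len (b ^+ j) for every j ([conj_of_len]).  Indeed the numbers
    of fixed points of the powers of a permutation determine, by recursion over
    divisors, how many points lie on cycles of each length m; two permutations
    of the same degree d whose counts nearly agree for all m < M can be
    conjugated into each other outside about 2d/M points, by superposing their
    cycles of equal length and then laying out the remaining cycles end to end
    ([near_conjugate]).  It therefore suffices that an automorphism Phi
    preserves len ([aut_len]), and this is done in two steps.

    Involutions.  By the above, the class of an involution is its length, so Phi
    acts on the possible lengths.  Commuting involutions built from Klein four
    groups acting on blocks of four points ([klein_triple]) show that an
    involution a with len a <= N * len b, N >= 2, is a product of at most N
    involutions of the same length as the involution b; hence
    len (Phi a) <= N * len (Phi b) ([morph_len_scaling]).  Comparing with an
    involution of length 1/M, using the inverse of Phi for the bound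
    (M - 1) * len (Phi t) <= 1 and letting M tend to infinity, one gets
    len (Phi a) <= len a, and equality by symmetry.

    Arbitrary elements.  Every permutation is a product u * v of two involutions
    that fix all its fixed points (reflect every cycle), and almost all of its
    fixed points are moved by another involution i.  The supports of i and u
    being disjoint is expressed by len (i * u) = len i + len u, a relation
    between lengths of involutions, which Phi preserves; so Phi i is disjoint
    from Phi u and from Phi v, hence from their product Phi a, and
    len (Phi a) <= 1 - len (Phi i) = 1 - len i = len a ([aut_len_le]). *)

Set Implicit Arguments.
Unset Strict Implicit.
Unset Printing Implicit Defensive.

Local Open Scope group_scope.

(** * Permutations as products of two involutions *)

Section Cycles.
Variable T : finType.
Implicit Types (s : {perm T}) (x y z b : T) (rs : seq T).

Definition orbit_root s x := odflt x [pick y in porbit s x].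

Lemma orbit_root_in s x : orbit_root s x \in porbit s x.
Proof.
by rewrite /orbit_root; case: pickP => //= /(_ x); rewrite porbit_id.
Qed.

Lemma eq_orbit_root s x y : y \in porbit s x -> orbit_root s y = orbit_root s x.
Proof.
rewrite /orbit_root -eq_porbit_mem => /eqP ->.
by case: pickP => //= /(_ x); rewrite porbit_id.
Qed.

Lemma orbit_root_exp s x : exists i, (s ^+ i) (orbit_root s x) == x.
Proof.
have := orbit_root_in s x; rewrite porbit_sym => /porbitP[i e].
by exists i; apply/eqP.
Qed.

(** On each cycle, indexed from its root, this is the reflection i |-> -i. *)
Definition orbit_flip s x := (s ^- xchoose (orbit_root_exp s x)) (orbit_root s x).

(** The exponent is only determined modulo the length of the cycle, but so is
    the reflected point. *)
Lemma orbit_flipE s x i :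
  (s ^+ i) (orbit_root s x) = x -> orbit_flip s x = (s ^- i) (orbit_root s x).
Proof.
move=> e; rewrite /orbit_flip; have /eqP := xchooseP (orbit_root_exp s x).
move: (xchoose _) => j ej.
apply: (@perm_inj _ (s ^+ i)); apply: (@perm_inj _ (s ^+ j)).
rewrite -!permM -expgD [in LHS]addnC !expgD !mulKg.
by rewrite e ej.
Qed.

Lemma orbit_root_flip s x : orbit_root s (orbit_flip s x) = orbit_root s x.
Proof.
rewrite -[RHS](eq_orbit_root (orbit_root_in s x)); apply: eq_orbit_root.
by rewrite /orbit_flip -porbitV -expgVn mem_porbit.
Qed.

Lemma orbit_flipK s : involutive (orbit_flip s).
Proof.
move=> x; have [i /eqP ei] := orbit_root_exp s x.
have [j /eqP ej] := orbit_root_exp s (orbit_flip s x).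
rewrite (orbit_flipE ej) orbit_root_flip.
rewrite orbit_root_flip (orbit_flipE ei) in ej.
apply: (@perm_inj _ (s ^+ j)); rewrite -permM mulVg perm1.
by rewrite -[x in RHS]ei -permM -expgD addnC expgD permM ej -permM mulVg perm1.
Qed.

Lemma orbit_flip_conj s x : orbit_flip s (s x) = s^-1 (orbit_flip s x).
Proof.
have rs : orbit_root s (s x) = orbit_root s x.
  by apply: eq_orbit_root; apply: (mem_porbit s 1).
have [i /eqP ei] := orbit_root_exp s x.
have ei1 : (s ^+ i.+1) (orbit_root s (s x)) = s x by rewrite expgSr permM rs ei.
by rewrite (orbit_flipE ei1) (orbit_flipE ei) rs -permM -invgM -expgS.
Qed.

(** A rotation is the product of two reflections: the flip [u] conjugates [s] to
    its inverse, so [s * u] is again an involution. *)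
Lemma perm_mul_involutions s : exists u v : {perm T},
  [/\ s = u * v, u * u = 1, v * v = 1 &
      forall x, s x = x -> u x = x /\ v x = x].
Proof.
pose u := perm (inv_inj (orbit_flipK s)).
have uu : u * u = 1 by apply/permP => x; rewrite permM !permE orbit_flipK.
exists (s * u), u; split => //.
- by rewrite -mulgA uu mulg1.
- apply/permP => x; rewrite !permM perm1 !permE orbit_flip_conj.
  by rewrite orbit_flipK permK.
move=> x sx; have ux : u x = x.
  rewrite permE; have := orbit_root_in s x; case/porbitP=> i.
  rewrite (_ : (s ^+ i) x = x); last first.
    by elim: i => [|i IH]; rewrite ?perm1 // expgSr permM IH.
  move=> r; rewrite (@orbit_flipE s x 0) ?r ?perm1 //.
  by rewrite expg0 invg1 perm1.
by rewrite permM sx.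
Qed.

End Cycles.

(** * Permutations with nearly the same cycle lengths are nearly conjugate *)

(** The model permutation of the naturals below [sumn sh], which rotates
    consecutive intervals of lengths [sh]. *)
Fixpoint interval_cycles (sh : seq nat) (j : nat) : nat :=
  if sh is h :: sh' then
    if (j < h)%N then (if (j.+1 < h)%N then j.+1 else 0%N)
    else (h + interval_cycles sh' (j - h))%N
  else j.

Lemma interval_cycles_lt sh j :
  (j < sumn sh)%N -> (interval_cycles sh j < sumn sh)%N.
Proof.
elim: sh j => [|h sh IH] j //= jlt.
case: ifP => jh; last by have := IH (j - h)%N; lia.
by case: ifP; lia.
Qed.

Lemma iota0D h k : iota 0 (h + k) = iota 0 h ++ map (addn h) (iota 0 k).
Proof. by rewrite iotaD add0n -iotaDl addn0. Qed.

(** Except at the last point of each interval, the model is the successor map,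
    whatever the lengths are.  This is why leftover cycles of different lengths
    cost only their number and not their size. *)
Lemma interval_cycles_bad sh :
  (count (fun j => interval_cycles sh j != j.+1) (iota 0 (sumn sh)) <= size sh)%N.
Proof.
elim: sh => //= h sh IH; rewrite iota0D count_cat -add1n leq_add //.
  apply: (@leq_trans (count_mem h.-1 (iota 0 h))); last first.
    by rewrite count_uniq_mem ?iota_uniq // leq_b1.
  apply: (@leq_trans (count (predI (fun j => j < h)%N (pred1 h.-1)) (iota 0 h))).
    apply/eq_leq/eq_in_count => j; rewrite mem_iota /= add0n => jh.
    by rewrite jh; case: ifP => /=; lia.
  by apply: sub_count => j /= /andP[].
rewrite count_map; apply: leq_trans IH; apply: sub_count => j /=.
by rewrite ltnNge leq_addr /= addKn -addnS eqn_add2l.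
Qed.

Lemma interval_cycles_diff C A B : sumn (C ++ A) = sumn (C ++ B) ->
  (count (fun j => interval_cycles (C ++ A) j != interval_cycles (C ++ B) j)
     (iota 0 (sumn (C ++ A))) <= size A + size B)%N.
Proof.
elim: C => [|h C IH] /= eAB; last first.
  rewrite iota0D count_cat; move: (IH (addnI eAB)) => {}IH.
  rewrite (_ : count _ (iota 0 h) = 0%N) ?add0n; last first.
    apply/eqP; rewrite -leqn0 leqNgt -has_count; apply/hasPn => j.
    by rewrite mem_iota /= add0n => ->; rewrite eqxx.
  rewrite count_map; apply: leq_trans IH; apply: sub_count => j /=.
  by rewrite ltnNge leq_addr /= addKn eqn_add2l.
have := leq_add (interval_cycles_bad A) (interval_cycles_bad B).
rewrite -eAB; apply: leq_trans; rewrite -count_predUI.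
apply: leq_trans (leq_addr _ _); apply: sub_count => j /=.
by case: (eqVneq (interval_cycles A j) j.+1) => [->|] //=; rewrite eq_sym.
Qed.

(** Matching off equal entries of two lists as long as possible leaves
    remainders without a common value. *)
Lemma common_part (r t : seq nat) : exists C A B,
  [/\ perm_eq r (C ++ A), perm_eq t (C ++ B) & forall m, m \in A -> m \notin B].
Proof.
elim: r t => [|m r IH] t; first by exists [::], [::], t; split.
have [mt|mt] := boolP (m \in t).
  have [C [A [B [h1 h2 h3]]]] := IH (rem m t).
  exists (m :: C), A, B; split => //=; first by rewrite perm_cons.
  by apply: perm_trans (perm_to_rem mt) _; rewrite perm_cons.
have [C [A [B [h1 h2 h3]]]] := IH t.
exists C, (m :: A), B; split => //.
  by rewrite perm_sym -cat1s perm_catCA /= perm_cons perm_sym.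
move=> p; rewrite inE => /predU1P[->|/h3 //].
by apply: contra mt => mB; rewrite (perm_mem h2) mem_cat mB orbT.
Qed.

(** Entries that are at least [M] number at most [sumn A / M]; the bound is
    stated after multiplication by [M]. *)
Lemma size_le_count_sumn (A : seq nat) M :
  (M * size A <= M * (\sum_(m < M) count_mem (m : nat) A) + sumn A)%N.
Proof.
elim: A => [|a A IH] /=; first by rewrite muln0.
rewrite big_split /= mulnDr mulnS.
suff h : (M <= M * (\sum_(m < M) (a == m)) + a)%N.
  by apply: leq_trans (leq_add h IH) _; rewrite addnACA.
case: (ltnP a M) => aM; last by lia.
by rewrite (bigD1 (Ordinal aM)) //= eqxx; lia.
Qed.

(** As the remainders share no value, one of the two counts vanishes and the
    other one is the excess. *)
Lemma count_disjoint_rest (r t C A B : seq nat) m :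
  perm_eq r (C ++ A) -> perm_eq t (C ++ B) -> (forall m, m \in A -> m \notin B) ->
  (count_mem m A + count_mem m B)%N =
    ((count_mem m r - count_mem m t) + (count_mem m t - count_mem m r))%N.
Proof.
move=> /seq.permP -> /seq.permP -> disj; rewrite !count_cat.
have [/disj mB|mA] := boolP (m \in A); first by rewrite (count_memPn mB); lia.
by rewrite (count_memPn mA); lia.
Qed.

Section NearConj.
Variable T : finType.
Implicit Types (s x y : {perm T}) (t b : T) (rs : seq T).

(** A list with exactly one point on each cycle, in a prescribed order: ordering
    the cycles is what makes equal cycles of two permutations match up. *)
Definition transversal_seq s rs :=
  forall t, count (fun b => t \in porbit s b) rs = 1%N.

Lemma transversal_seq_perm s rs rs' :
  perm_eq rs rs' -> transversal_seq s rs -> transversal_seq s rs'.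
Proof. by move=> /seq.permP e h t; rewrite -e. Qed.

Lemma exists_transversal_seq s : exists rs, transversal_seq s rs.
Proof.
exists [seq t <- enum T | orbit_root s t == t] => t.
rewrite count_filter -(_ : count (pred1 (orbit_root s t)) (enum T) = 1%N).
  apply: eq_count => b /=; apply/andP/eqP => [[tb /eqP <-]|->].
    by rewrite (eq_orbit_root tb).
  rewrite porbit_sym orbit_root_in; split=> //; apply/eqP.
  by rewrite (eq_orbit_root (orbit_root_in s t)).
by rewrite count_uniq_mem ?enum_uniq // mem_enum.
Qed.

Definition orbit_sizes s rs := map (fun b => #|porbit s b|) rs.

Definition cycle_list s rs :=
  flatten (map (fun b => traject s b #|porbit s b|) rs).

Lemma count_traject_porbit s b t :
  count_mem t (traject s b #|porbit s b|) = (t \in porbit s b).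
Proof. by rewrite count_uniq_mem ?uniq_traject_porbit // porbit_traject. Qed.

Lemma cycle_list_perm s rs :
  transversal_seq s rs -> perm_eq (cycle_list s rs) (enum T).
Proof.
move=> tr; apply/allP => t _ /=.
rewrite (@count_uniq_mem _ (enum T)) ?enum_uniq // mem_enum inE /=.
rewrite -(tr t) /cycle_list count_flatten -map_comp /=.
rewrite sumnE big_map -sum1_count [eqbRHS]big_mkcond /=; apply/eqP.
by apply: eq_bigr => b _; rewrite count_traject_porbit; case: (_ \in _).
Qed.

Lemma size_cycle_list s rs : size (cycle_list s rs) = sumn (orbit_sizes s rs).
Proof.
rewrite size_flatten /shape -map_comp; congr sumn.
by apply: eq_map => b /=; rewrite size_traject.
Qed.

(** Enumerated cycle after cycle, [s] becomes the model permutation. *)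
Lemma cycle_list_next s rs t0 j : (j < size (cycle_list s rs))%N ->
  s (nth t0 (cycle_list s rs) j) =
  nth t0 (cycle_list s rs) (interval_cycles (orbit_sizes s rs) j).
Proof.
elim: rs j => [|b rs IH] j //=.
rewrite /cycle_list /= -/(cycle_list s rs) size_cat !nth_cat size_traject => jlt.
case: (ltnP j #|porbit s b|) => jh; last first.
  by rewrite ltnNge leq_addr /= addKn IH // ltn_subLR.
have nt i : (i < #|porbit s b|)%N ->
    nth t0 (traject s b #|porbit s b|) i = iter i s b.
  by move=> ilt; rewrite (set_nth_default b) ?size_traject // nth_traject.
rewrite nt //; case: (ltnP j.+1 #|porbit s b|) => j1; first by rewrite j1 nt.
have e : #|porbit s b| = j.+1 by apply/eqP; rewrite eqn_leq jh j1.
by rewrite {1}e /= nt ?e //= -[RHS](iter_porbit s b) e.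
Qed.

Lemma transversal_reorder s rs sh : transversal_seq s rs ->
  perm_eq (orbit_sizes s rs) sh ->
  exists rs', transversal_seq s rs' /\ orbit_sizes s rs' = sh.
Proof.
move=> tr; rewrite perm_sym => /(perm_iotaP 0)[Is]; rewrite size_map => pI ->.
case: rs tr pI => [|b rs] tr pI.
  by exists [::]; split=> //; move: pI => /perm_size /=; case: Is.
exists (map (nth b (b :: rs)) Is); split.
  apply: transversal_seq_perm tr; rewrite -{1}(mkseq_nth b (b :: rs)).
  by rewrite perm_sym perm_map.
rewrite /orbit_sizes -map_comp; apply/eq_in_map => i.
rewrite (perm_mem pI) mem_iota add0n => ilt.
exact/esym/(nth_map b 0%N (fun b => #|porbit s b|) ilt).
Qed.

Definition cycle_points s m := [set t | #|porbit s t| == m].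

Lemma cycle_points0 s : cycle_points s 0 = set0.
Proof.
apply/setP => t; rewrite !inE; apply/negbTE; rewrite -lt0n card_gt0.
by apply/set0Pn; exists t; apply: porbit_id.
Qed.

Lemma count_orbit_sizes s rs m : transversal_seq s rs ->
  #|cycle_points s m| = (m * count_mem m (orbit_sizes s rs))%N.
Proof.
move=> tr; rewrite cardE size_filter.
have -> : count (mem (cycle_points s m)) (Finite.enum T) =
          count (mem (cycle_points s m)) (enum T) by rewrite enumT.
rewrite -(seq.permP (cycle_list_perm tr)) count_flatten -map_comp.
rewrite count_map sumnE big_map -sum1_count big_distrr /= [RHS]big_mkcond /=.
apply: eq_bigr => b _; rewrite muln1.
have -> : count (mem (cycle_points s m)) (traject s b #|porbit s b|) =
    count (fun=> #|porbit s b| == m) (traject s b #|porbit s b|).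
  apply: eq_in_count => t; rewrite -porbit_traject -eq_porbit_mem => /eqP e.
  by rewrite /= /cycle_points inE e.
case: eqP => [e|_]; first by rewrite count_predT size_traject.
by rewrite count_pred0.
Qed.

Lemma sumn_orbit_sizes s rs : transversal_seq s rs ->
  sumn (orbit_sizes s rs) = #|T|.
Proof.
by move=> tr; rewrite -size_cycle_list (perm_size (cycle_list_perm tr)) cardE.
Qed.

(** The conjugator sends the j-th point of one enumeration to the j-th point of
    the other one. *)
Lemma conj_same_enumeration x y rx ry :
  transversal_seq x rx -> transversal_seq y ry ->
  exists g, (#|[set t | (x ^ g)%g t != y t]| <=
    count (fun j => interval_cycles (orbit_sizes x rx) j !=
             interval_cycles (orbit_sizes y ry) j) (iota 0 #|T|))%N.
Proof.
move=> trx try_; have px := cycle_list_perm trx; have py := cycle_list_perm try_.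
case: (pickP (@predT T)) => [t0 _|noT]; last first.
  exists 1; rewrite (_ : [set _ | _] = set0) ?cards0 //.
  by apply/setP => t; have := noT t.
pose ex := cycle_list x rx; pose ey := cycle_list y ry.
have ux : uniq ex by rewrite (perm_uniq px) enum_uniq.
have uy : uniq ey by rewrite (perm_uniq py) enum_uniq.
have sx : size ex = #|T| by rewrite (perm_size px) -cardE.
have sy : size ey = #|T| by rewrite (perm_size py) -cardE.
have inx t : t \in ex by rewrite (perm_mem px) mem_enum.
pose g0 t := nth t0 ey (index t ex).
have g0_inj : injective g0.
  move=> t t' /eqP; rewrite /g0 nth_uniq ?sy -?sx ?index_mem ?inx //.
  by move=> /eqP e; rewrite -(nth_index t0 (inx t)) e nth_index.
pose g := perm g0_inj.
have gE j : (j < #|T|)%N -> g (nth t0 ex j) = nth t0 ey j.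
  by move=> jT; rewrite permE /g0 index_uniq ?sx.
exists g; rewrite -(card_imset _ (@perm_inj _ g^-1)).
have -> : [set g^-1 t | t in [set t | (x ^ g)%g t != y t]] =
    [set t | g (x t) != y (g t)].
  apply/setP => t; rewrite -{1}(permK g t) mem_imset; last exact: perm_inj.
  by rewrite !inE permJ.
rewrite cardE size_filter.
have -> : count (mem [set t | g (x t) != y (g t)]) (Finite.enum T) =
    count (mem [set t | g (x t) != y (g t)]) (enum T) by rewrite enumT.
rewrite -(seq.permP px) -/ex -(mkseq_nth t0 ex) sx count_map.
apply/eq_leq/eq_in_count => j; rewrite mem_iota /= add0n => jT.
rewrite inE cycle_list_next ?sx // gE // cycle_list_next ?sy // gE; last first.
  by rewrite -(sumn_orbit_sizes trx) interval_cycles_lt ?sumn_orbit_sizes.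
rewrite nth_uniq // sy.
  by rewrite -(sumn_orbit_sizes trx) interval_cycles_lt ?sumn_orbit_sizes.
by rewrite -(sumn_orbit_sizes try_) interval_cycles_lt ?sumn_orbit_sizes.
Qed.

(** Order the cycles so that cycles of equal lengths come first and in the same
    order: the error is at most the number of unmatched cycles.  Those of length
    less than [M] are counted by the differences in the sum, and there are at
    most [#|T| / M] longer ones in each permutation.  The conjugator does not
    depend on [M], which permits to choose it once for all [M]. *)
Lemma near_conjugate x y : exists g, forall M,
  (M * #|[set t | (x ^ g)%g t != y t]| <=
   M * (\sum_(m < M) ((#|cycle_points x m| - #|cycle_points y m|) +
                   (#|cycle_points y m| - #|cycle_points x m|))) + 2 * #|T|)%N.
Proof.
have [rx trx] := exists_transversal_seq x.
have [ry try_] := exists_transversal_seq y.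
have [C [A [B [pA pB disj]]]] := common_part (orbit_sizes x rx) (orbit_sizes y ry).
have [rx' [trx' eA]] := transversal_reorder trx pA.
have [ry' [try' eB]] := transversal_reorder try_ pB.
have sA := sumn_orbit_sizes trx'; have sB := sumn_orbit_sizes try'.
have [g hg] := conj_same_enumeration trx' try'; exists g => M.
rewrite eA eB in hg sA sB.
have {}hg : (#|[set t | (x ^ g)%g t != y t]| <= size A + size B)%N.
  apply: leq_trans hg _; rewrite -{1}sA; apply: interval_cycles_diff.
  by rewrite sA sB.
apply: leq_trans (leq_mul (leqnn M) hg) _.
rewrite mulnDr.
apply: leq_trans (leq_add (size_le_count_sumn A M) (size_le_count_sumn B M)) _.
rewrite addnACA -mulnDr leq_add //; last first.
  by move: sA sB; rewrite !sumn_cat; lia.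
rewrite leq_mul2l -big_split /=; apply/orP; right.
apply: leq_sum => -[m mM] _ /=; rewrite (count_disjoint_rest m pA pB disj).
rewrite (count_orbit_sizes m trx) (count_orbit_sizes m try_).
case: m mM => [|m] mM; last by rewrite -!mulnBr leq_add // leq_pmull.
have c0 s rs : count_mem 0%N (orbit_sizes s rs) = 0%N.
  apply/count_memPn/mapP => -[b _ /esym/eqP]; rewrite cards_eq0 => /eqP p0.
  by have := porbit_id s b; rewrite p0 inE.
by rewrite !c0.
Qed.

Lemma fixed_expg s t j : ((s ^+ j) t == t) = (#|porbit s t| %| j)%N.
Proof.
have itE i : iter i s t = (s ^+ i) t by rewrite permX.
set m := #|porbit s t|; have m0 : (0 < m)%N.
  by rewrite card_gt0; apply/set0Pn; exists t; apply: porbit_id.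
have sm : (s ^+ m) t = t by rewrite -itE iter_porbit.
have -> : (s ^+ j) t = (s ^+ (j %% m)) t.
  rewrite {1}(divn_eq j m) expgD permM; congr (_ _).
  by elim: (j %/ m)%N => [|q IH]; rewrite ?perm1 // mulSn expgD permM sm.
rewrite /dvdn; have := uniq_traject_porbit s t; rewrite -/m => u.
have lt := ltn_pmod j m0.
rewrite -(nth_uniq t _ _ u) ?size_traject // !nth_traject //.
by rewrite itE.
Qed.

Lemma card_fixed_expg s j : (0 < j)%N ->
  #|[set t | (s ^+ j) t == t]| = (\sum_(m < j.+1 | m %| j) #|cycle_points s m|)%N.
Proof.
move=> j0; rewrite -sum1_card.
transitivity (\sum_t \sum_(m < j.+1 | (m %| j) && (#|porbit s t| == m :> nat)) 1)%N.
  rewrite big_mkcond /=; apply: eq_bigr => t _; rewrite inE fixed_expg.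
  case: ifP => dv.
    have lt : (#|porbit s t| < j.+1)%N by rewrite ltnS dvdn_leq.
    rewrite (big_pred1 (Ordinal lt)) // => m /=.
    by apply/andP/eqP => [[_ /eqP e]|->] //=; first exact/val_inj.
  by rewrite big_pred0 // => m; apply/andP => -[h /eqP e]; rewrite e h in dv.
rewrite (exchange_big_dep (fun m : 'I_j.+1 => m %| j)%N) /=;
  last by move=> t m _ /andP[].
apply: eq_bigr => m mj; rewrite -sum1_card; apply: eq_bigl => t.
by rewrite inE mj.
Qed.

End NearConj.

(** * Supports, and involutions with prescribed supports *)

Section Moved.
Variable T : finType.
Implicit Types (i u v s : {perm T}) (D : {set T}).

Definition moved s := [set t | s t != t].

Lemma moved1 : moved 1 = set0.
Proof. by apply/setP => t; rewrite !inE perm1 eqxx. Qed.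

Lemma moved_subM u v : moved (u * v) \subset moved u :|: moved v.
Proof.
apply/subsetP => t; rewrite !inE permM.
by case: (eqVneq (u t) t) => //= ->.
Qed.

Lemma card_movedM_common i u :
  (#|moved (i * u)| + #|moved i :&: moved u| <= #|moved i| + #|moved u|)%N.
Proof.
by rewrite -[leqRHS]cardsUI leq_add2r subset_leq_card // moved_subM.
Qed.

(** The defect [#|moved i| + #|moved u| - #|moved (i * u)|] bounds the overlap of
    the supports of [i] and [u].  If it is small for [u] and for [v], the support
    of [i] almost avoids that of [u * v].  Subtractions are moved to the other
    side. *)
Lemma card_moved_almost_disjoint i u v :
  (#|moved i| + #|moved (u * v)| + (#|moved (i * u)| + #|moved (i * v)|) <=
   #|T| + ((#|moved i| + #|moved u|) + (#|moved i| + #|moved v|)))%N.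
Proof.
have hu := card_movedM_common i u; have hv := card_movedM_common i v.
have h : (#|moved i :&: moved (u * v)| <=
    #|moved i :&: moved u| + #|moved i :&: moved v|)%N.
  apply: leq_trans (leq_card_setU _ _); rewrite -setIUr.
  by apply/subset_leq_card/setIS/moved_subM.
have hT : (#|moved i :|: moved (u * v)| <= #|T|)%N by apply: max_card.
have := cardsUI (moved i) (moved (u * v)); lia.
Qed.

Lemma moved_disjointM i u : [disjoint moved i & moved u] ->
  i * u = u * i /\ moved (i * u) = moved i :|: moved u.
Proof.
move=> dis.
have fixed s t : t \in moved s -> s t \in moved s.
  by rewrite !inE; apply: contra => /eqP/perm_inj ->.
have iu t : t \in moved i -> u t = t.
  by move=> /(disjointFr dis); rewrite inE => /negbFE/eqP.
have ui t : t \in moved u -> i t = t.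
  by move=> /(disjointFl dis); rewrite inE => /negbFE/eqP.
split.
  apply/permP => t; rewrite !permM.
  have [ti|] := boolP (t \in moved i); first by rewrite (iu _ ti) iu // fixed.
  rewrite inE negbK => /eqP it; rewrite it.
  have [tu|] := boolP (t \in moved u); first by rewrite ui // fixed.
  by rewrite inE negbK => /eqP ->; rewrite it.
apply/setP => t; rewrite !inE permM.
have [ti|] := boolP (t \in moved i).
  by rewrite iu ?fixed //; move: ti; rewrite inE => ->.
rewrite inE negbK => /eqP it; rewrite it eqxx //.
Qed.

(** Pair off the points of [D]; at most one of them is left. *)
Lemma involution_in D : exists i,
  [/\ i * i = 1, moved i \subset D & (#|D| <= #|moved i|.+1)%N].
Proof.
have [m] := ubnP #|D|; elim: m D => // m IH D Dm.
have [D1|/card_gt1P[x [y [xD yD xy]]]] := leqP #|D| 1.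
  by exists 1; rewrite mulg1 moved1 sub0set cards0.
have cD : #|D| = #|D :\: [set x; y]|.+2.
  rewrite -[LHS](cardsID [set x; y]) (_ : D :&: _ = [set x; y]).
    by rewrite cards2 xy.
  by apply/setIidPr/subsetP => z; rewrite !inE => /orP[]/eqP ->.
have [|i [ii iD Di]] := IH (D :\: [set x; y]); first by lia.
have mt : moved (tperm x y) = [set x; y].
  apply/setP => z; rewrite !inE; case: tpermP => [->|->|/eqP zx /eqP zy].
  - by rewrite eq_sym xy eqxx.
  - by rewrite xy eqxx orbT.
  - by rewrite eqxx (negbTE zx) (negbTE zy).
have dis : [disjoint moved (tperm x y) & moved i].
  rewrite mt disjoint_sym; apply: disjointWl iD _.
  by rewrite -setI_eq0 setIDAC setDIl setDv setI0.
have [com mv] := moved_disjointM dis.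
exists (tperm x y * i); split.
- by rewrite {2}com mulgA -(mulgA _ i i) ii mulg1 tperm2.
- rewrite mv subUset mt; apply/andP; split.
    by apply/subsetP => z; rewrite !inE => /orP[]/eqP ->.
  by apply: subset_trans iD (subsetDl _ _).
have := cardsUI (moved (tperm x y)) (moved i).
move: dis; rewrite -mv -setI_eq0 => /eqP ->.
by rewrite cards0 mt cards2 xy; lia.
Qed.

Lemma involution_decomposition s : exists i u v : {perm T},
  [/\ s = u * v, [/\ i * i = 1, u * u = 1 & v * v = 1],
      (i * u) * (i * u) = 1 /\ (i * v) * (i * v) = 1,
      #|moved (i * u)| = (#|moved i| + #|moved u|)%N /\
      #|moved (i * v)| = (#|moved i| + #|moved v|)%N &
      (#|moved i| + #|moved s| <= #|T| <= (#|moved i| + #|moved s|).+1)%N].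
Proof.
have [u [v [suv uu vv fx]]] := perm_mul_involutions s.
have [i [ii iD Di]] := involution_in (~: moved s).
have us (w : {perm T}) :
    (forall t, s t = t -> w t = t) -> [disjoint moved i & moved w].
  move=> h; apply: disjointWl iD _; rewrite -setI_eq0; apply/eqP/setP => t.
  by rewrite !inE negbK; case: eqP => // /h ->; rewrite eqxx.
have du : [disjoint moved i & moved u] by apply: us => t /fx[].
have dv : [disjoint moved i & moved v] by apply: us => t /fx[].
have [cu mu] := moved_disjointM du; have [cv mv] := moved_disjointM dv.
have sq w : i * w = w * i -> w * w = 1 -> (i * w) * (i * w) = 1.
  by move=> c ww; rewrite {2}c mulgA -(mulgA _ w w) ww mulg1.
have cd w : [disjoint moved i & moved w] ->
    #|moved i :|: moved w| = (#|moved i| + #|moved w|)%N.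
  by rewrite -setI_eq0 => /eqP d; rewrite -cardsUI d cards0 addn0.
exists i, u, v; split; rewrite ?mu ?mv ?cd ?sq //.
have := cardsC (moved s); have := subset_leq_card iD; lia.
Qed.

End Moved.

(** * Commuting involutions with prescribed numbers of moved points *)

Section KleinBlocks.
Variable n : nat.

(** Write [r < 4] in binary and flip the low bit according to [a], the high bit
    according to [b]: an action of the Klein four group on four points. *)
Definition klein_flip (a b : bool) (r : nat) : nat :=
  ((a (+) odd r) + (b (+) (1 < r)%N).*2)%N.

(** An incomplete last block is left fixed, so that the points below [n] are
    permuted. *)
Definition block_flip (a b : pred nat) (i : nat) : nat :=
  if (4 * (i %/ 4) + 4 <= n)%N then
    (4 * (i %/ 4) + klein_flip (a (i %/ 4)) (b (i %/ 4)) (i %% 4))%N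
  else i.

Lemma klein_flip_lt a b r : (klein_flip a b r < 4)%N.
Proof. by rewrite /klein_flip; case: (_ (+) _); case: (_ (+) _). Qed.

Lemma klein_flipM a b a' b' r : (r < 4)%N ->
  klein_flip a' b' (klein_flip a b r) = klein_flip (a (+) a') (b (+) b') r.
Proof. by case: r => [|[|[|[|//]]]]; case: a a' b b' => [] [] [] []. Qed.

Lemma klein_flip_eq a b r : (r < 4)%N -> (klein_flip a b r != r) = a || b.
Proof. by case: r => [|[|[|[|//]]]]; case: a b => [] []. Qed.

Lemma block_flip_lt a b (i : 'I_n) : (block_flip a b i < n)%N.
Proof.
rewrite /block_flip; case: ifP => // h.
by apply: leq_trans h; rewrite ltn_add2l klein_flip_lt.
Qed.

Lemma block_flipM a b a' b' i : block_flip a' b' (block_flip a b i) =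
  block_flip (fun j => a j (+) a' j) (fun j => b j (+) b' j) i.
Proof.
rewrite [block_flip a b i]/block_flip [RHS]/block_flip.
case: ifP => h; last by rewrite /block_flip h.
have lt := klein_flip_lt (a (i %/ 4)) (b (i %/ 4)) (i %% 4).
set k := klein_flip _ _ _ in lt *; set q := (i %/ 4)%N in k lt h *.
have qE : ((4 * q + k) %/ 4 = q)%N by lia.
have kE : ((4 * q + k) %% 4 = k)%N by lia.
by rewrite /block_flip qE kE h klein_flipM // ltn_mod.
Qed.

Lemma block_flipK a b : involutive (block_flip a b).
Proof.
move=> i; rewrite block_flipM /block_flip; case: ifP => // _.
rewrite !addbb [RHS](divn_eq i 4) mulnC; congr (_ + _)%N.
by have : (i %% 4 < 4)%N := @ltn_pmod i 4 isT; case: (i %% 4)%N => [|[|[|[|//]]]].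
Qed.

Lemma block_flip_neq a b i : (block_flip a b i != i) =
  (4 * (i %/ 4) + 4 <= n)%N && (a (i %/ 4) || b (i %/ 4))%N.
Proof.
rewrite /block_flip; case: ifP => [h|]; last by rewrite eqxx.
rewrite [X in _ != X](divn_eq i 4) mulnC eqn_add2l klein_flip_eq // ltn_mod //.
Qed.

Definition block_ord a b (i : 'I_n) := Ordinal (block_flip_lt a b i).

Lemma block_ordK a b : involutive (block_ord a b).
Proof. by move=> i; apply: val_inj; rewrite /= block_flipK. Qed.

Definition block_perm a b : 'S_n := perm (inv_inj (block_ordK a b)).

Lemma block_permK a b : block_perm a b * block_perm a b = 1.
Proof. by apply/permP => i; rewrite permM perm1 !permE block_ordK. Qed.

Lemma block_permM a b a' b' : block_perm a b * block_perm a' b' =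
  block_perm (fun j => a j (+) a' j) (fun j => b j (+) b' j).
Proof.
by apply/permP => i; rewrite permM !permE; apply: val_inj; rewrite /= block_flipM.
Qed.

Lemma card_ord_itv p q : (q <= n)%N -> #|[set i : 'I_n | p <= i < q]| = (q - p)%N.
Proof.
move=> qn; rewrite cardE size_filter -enumT.
transitivity (count (fun i => p <= i < q)%N (map val (enum 'I_n))).
  by rewrite count_map; apply: eq_count => i; rewrite /= inE.
rewrite val_enum_ord -(subnKC qn) iotaD count_cat add0n.
rewrite [X in (_ + X)%N](_ : _ = 0%N) ?addn0; last first.
  apply/eqP; rewrite -leqn0 leqNgt -has_count; apply/hasPn => i.
  by rewrite mem_iota; lia.
have [pq|qp] := leqP p q; last first.
  apply/eqP; rewrite (_ : q - p = 0)%N; last by lia.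
  rewrite -leqn0 leqNgt -has_count; apply/hasPn => i.
  by rewrite mem_iota; lia.
rewrite (_ : iota 0 q = iota 0 p ++ iota p (q - p)); last first.
  by rewrite -{1}(subnKC pq) iotaD.
rewrite count_cat.
rewrite [X in (X + _)%N](_ : _ = 0%N) ?add0n; last first.
  apply/eqP; rewrite -leqn0 leqNgt -has_count; apply/hasPn => i.
  by rewrite mem_iota; lia.
rewrite -[RHS](size_iota p (q - p)); apply/eqP; rewrite -all_count.
by apply/allP => i; rewrite mem_iota; lia.
Qed.

Lemma card_moved_block a b (c : pred nat) :
  (forall j, c j = a j || b j) -> (forall j, c j -> 4 * j + 4 <= n)%N ->
  moved (block_perm a b) = [set i : 'I_n | c (i %/ 4)]%N.
Proof.
move=> cE cn; apply/setP => i; rewrite !inE permE -val_eqE /= block_flip_neq -cE.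
by case: (boolP (c _)) => [/cn ->|_]; rewrite ?andbF.
Qed.

(** Colour the blocks by elements of the Klein group: [v] has the first colour on
    [0, S), and [w] has the second colour on [P, Q) and the first one on [Q, Z).
    The product moves the blocks where the colours of [v] and [w] differ, namely
    [0, Q) and [S, Z).  Using two colours, rather than disjoint or equal
    supports only, lets a fixed-point-free involution be a product of two
    fixed-point-free ones. *)
Lemma klein_triple P Q S Z : (P <= Q <= S)%N -> (S <= Z)%N -> (4 * Z <= n)%N ->
  exists v w : 'S_n, [/\ v * v = 1, w * w = 1 & (v * w) * (v * w) = 1] /\
   [/\ #|moved v| = 4 * S, #|moved w| = 4 * (Z - P) &
       #|moved (v * w)| = 4 * Q + 4 * (Z - S)]%N.
Proof.
move=> /andP[PQ QS] SZ Zn.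
pose v := block_perm (fun j => j < S)%N pred0.
pose w := block_perm (fun j => Q <= j < Z)%N (fun j => P <= j < Q)%N.
have vE : moved v = [set i : 'I_n | 0 <= i < 4 * S]%N.
  rewrite (@card_moved_block _ _ (fun j => j < S)%N).
  - by apply/setP => i; rewrite !inE; lia.
  - by move=> j; rewrite orbF.
  - by move=> j /=; lia.
have wE : moved w = [set i : 'I_n | 4 * P <= i < 4 * Z]%N.
  rewrite (@card_moved_block _ _ (fun j => P <= j < Z)%N).
  - by apply/setP => i; rewrite !inE; lia.
  - by move=> j /=; lia.
  - by move=> j /=; lia.
have vwE : moved (v * w) =
    [set i : 'I_n | 0 <= i < 4 * Q]%N :|: [set i : 'I_n | 4 * S <= i < 4 * Z]%N.
  rewrite block_permM (@card_moved_block _ _ (fun j => (j < Q) || (S <= j < Z))%N).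
  - by apply/setP => i; rewrite !inE; lia.
  - by move=> j /=; lia.
  - by move=> j /=; lia.
exists v, w; split; first (split; [exact: block_permK|exact: block_permK|]).
  by rewrite block_permM block_permK.
have := cardsUI [set i : 'I_n | 0 <= i < 4 * Q]%N
  [set i : 'I_n | 4 * S <= i < 4 * Z]%N.
rewrite (_ : _ :&: _ = set0) ?cards0; last first.
  by apply/setP => i; rewrite !inE; lia.
rewrite vE wE vwE !card_ord_itv //; try lia.
by rewrite addn0 => ->; rewrite !subn0 !mulnBr.
Qed.
End KleinBlocks.

(** * Limits along an ultrafilter *)

From mathcomp Require Import all_classical all_reals all_analysis.
Import numFieldNormedType.Exports.
Import Order.TTheory GRing.Theory Num.Theory.

Local Open Scope classical_set_scope.
Local Open Scope group_scope.

Lemma dep_choice (I : Type) (T : I -> Type) (Q : forall i, T i -> Prop) :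
  (forall i, exists t, Q i t) -> exists f : forall i, T i, forall i, Q i (f i).
Proof.
by move=> h; exists (fun i => projT1 (cid (h i))) => i; exact: projT2 (cid (h i)).
Qed.

Section UltraLimits.
Variables (R : realType) (I : Type) (omega : set_system I).

(** Compactness gives a cluster point, and an ultrafilter converges to each of
    its cluster points. *)
Lemma ultra_bounded_cvg {omegaU : UltraFilter omega} (u : I -> R) :
  (forall k, (0 <= u k <= 1)%R) -> exists l : R, u @ omega --> l.
Proof.
move=> u01.
have [|l [_ lc]] := @segment_compact R 0%R 1%R (fmap u omega) _.
  by apply: (@filterE _ omega) => k /=; rewrite in_itv /= u01.
exists l => A lA; have [//|nA] := in_ultra_setVsetC (u @^-1` A) omegaU.
by have [y []] := lc (~` A) A nA lA.
Qed.

Lemma cvg_sum0 {omegaF : Filter omega} (J : eqType) (r : seq J)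
    (P : pred J) (u : J -> I -> R) :
  (forall j, j \in r -> P j -> u j @ omega --> (0 : R)%R) ->
  (fun k => (\sum_(j <- r | P j) u j k)%R) @ omega --> (0 : R)%R.
Proof.
elim: r => [_|j r IH h].
  by under eq_fun do rewrite big_nil; apply: cvg_cst.
have {}IH := IH (fun i ir => h i (mem_behead (s := j :: r) ir)).
have [Pj|nPj] := boolP (P j); last first.
  by under eq_fun do rewrite big_cons (negbTE nPj).
under eq_fun do rewrite big_cons Pj.
have := cvgD (h j (mem_head _ _) Pj) IH; rewrite addr0; exact.
Qed.

Lemma ultra_ext (u v : I -> R) (l : R) :
  (forall k, u k = v k) -> v @ omega --> l -> u @ omega --> l.
Proof. by move=> /funext ->. Qed.

Lemma ultra_le {omegaU : UltraFilter omega} (u v : I -> R) (a b : R) :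
  u @ omega --> a -> v @ omega --> b -> (forall k, (u k <= v k)%R) -> (a <= b)%R.
Proof.
move=> ua vb uv; rewrite -subr_ge0.
have h : (v \- u)%R @ omega --> (b - a)%R by apply: cvgB.
by apply: (cvgr_to_ge h); apply: nearW => k /=; rewrite subr_ge0.
Qed.

Lemma ultra_unique {omegaU : UltraFilter omega} (u : I -> R) (a b : R) :
  u @ omega --> a -> u @ omega --> b -> a = b.
Proof. by move=> ua ub; apply: cvg_unique ua ub; apply: norm_hausdorff. Qed.

Lemma ultra_add {omegaU : UltraFilter omega} (u v : I -> R) (a b : R) :
  u @ omega --> a -> v @ omega --> b ->
  (fun k => u k + v k)%R @ omega --> (a + b)%R.
Proof. by move=> ua vb; apply: cvgD. Qed.

Lemma ultra_sub {omegaU : UltraFilter omega} (u v : I -> R) (a b : R) :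
  u @ omega --> a -> v @ omega --> b ->
  (fun k => u k - v k)%R @ omega --> (a - b)%R.
Proof. by move=> ua vb; apply: cvgB. Qed.

End UltraLimits.

Section Nonprincipal.
Variables (omega : set_system nat).
Context {omegaU : UltraFilter omega}.
Hypothesis omega_nonprincipal : forall k : nat, omega <> principal_filter k.

(** A nonprincipal ultrafilter contains no singleton, hence all cofinite sets. *)
Lemma nonprincipal_sub_oo : \oo `<=` omega.
Proof.
have notpt k : omega (~` [set k]).
  have [kk|//] := in_ultra_setVsetC [set k] omegaU.
  case: (omega_nonprincipal (k := k)).
  apply: (max_filter (UltraFilter := principal_filter_ultra k)).
  by move=> A /principal_filterP Ak; apply: filterS kk => _ ->.
move=> A [N _ NA]; apply: filterS NA _; elim: N => [|N IH].
  by apply: filterE => k /=.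
apply: filterS (filterI IH (notpt N)) => k [/= Nk kN].
by rewrite ltn_neqAle Nk andbT eq_sym; apply/eqP.
Qed.

End Nonprincipal.

Lemma morph_one (G H : groupType) (f : G -> H) :
  {morph f : a b / a * b} -> f 1 = 1.
Proof. by move=> fM; apply: (@mulgI _ (f 1)); rewrite -fM !mulg1. Qed.

Lemma morph_conj (G H : groupType) (f : G -> H) :
  {morph f : a b / a * b} -> {morph f : a b / a ^ b}.
Proof.
move=> fM a b; apply: (@mulgI _ (f b)).
by rewrite -fM conjgE mulKVg fM conjgE mulKVg.
Qed.

(** * The length function of the universal sofic group *)

Section UniversalSoficGroup.
Variables (R : realType) (omega : set_system nat).
Context {omegaU : UltraFilter omega}.
Variable n : nat -> nat.
Local Notation G := (universal_sofic R omega n).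
Local Notation P := (prodg (fun k => 'S_(n k))).

Definition sofic_class (x : P) : G := \pi_(quotg (N_omega R omega n))%qT x.
Local Notation cl := sofic_class.

Implicit Types (x y z : P) (a b c g : G).

Lemma dHamm1E m (p : 'S_m) : dHamm R p 1 = (#|moved p|%:R / m%:R)%R.
Proof.
by rewrite /dHamm; congr (_%:R / _)%R; apply: eq_card => i; rewrite !inE perm1.
Qed.

Lemma dHamm1_bounds m (p : 'S_m) : (0 <= dHamm R p 1 <= 1)%R.
Proof.
rewrite dHamm_ge0 /=.
case: (posnP m) p => [->|m0] p; first by rewrite /dHamm invr0 mulr0 ler01.
rewrite dHamm1E ler_pdivrMr ?ltr0n // mul1r ler_nat.
by rewrite -[leqRHS]card_ord max_card.
Qed.

Lemma dHamm_almost_disjoint m (i u v : 'S_m) :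
  (dHamm R i 1 + dHamm R (u * v) 1 + (dHamm R (i * u) 1 + dHamm R (i * v) 1) <=
   1 + ((dHamm R i 1 + dHamm R u 1) + (dHamm R i 1 + dHamm R v 1)))%R.
Proof.
case: (posnP m) i u v => [->|m0] i u v.
  by rewrite /dHamm !invr0 !mulr0 !addr0 ler01.
rewrite !dHamm1E -!mulrDl.
have m0' : (m%:R != 0 :> R)%R by rewrite pnatr_eq0 -lt0n.
rewrite -[X in (_ <= X + _)%R](divff m0').
rewrite -mulrDl ler_wpM2r ?invr_ge0 ?ler0n // -!natrD ler_nat.
by have := card_moved_almost_disjoint i u v; rewrite card_ord.
Qed.

Lemma cl_ext x y : (forall k, x k = y k) -> cl x = cl y.
Proof. by move=> e; congr (cl _); apply: functional_extensionality_dep. Qed.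

Lemma cl_surj a : exists x, a = cl x.
Proof. by exists (generic_quotient.repr a); rewrite /sofic_class reprK. Qed.

Lemma clM x y : cl (x * y) = cl x * cl y.
Proof. exact: pi_mulg. Qed.

Lemma clV x : cl x^-1 = (cl x)^-1.
Proof. exact: pi_invg. Qed.

Lemma clX x j : cl (x ^+ j) = cl x ^+ j.
Proof. by elim: j => [|j IH]; rewrite ?expg0 // !expgS clM IH. Qed.

Lemma cl_eq x y : (fun k => dHamm R ((x k)^-1 * y k) 1) @ omega --> (0 : R)%R ->
  cl x = cl y.
Proof. by move=> h; apply/eqP/quotgP. Qed.

Lemma prodg_expE x j k : (x ^+ j) k = x k ^+ j.
Proof. by elim: j => [|j IH]; rewrite ?expg0 // !expgS -IH. Qed.

Definition len a : R :=
  lim ((fun k => dHamm R ((generic_quotient.repr a : P) k) 1) @ omega).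

(** The limit does not depend on the representative: the lengths of two
    permutations differ by at most their distance. *)
Lemma len_cvg x : (fun k => dHamm R (x k) 1) @ omega --> len (cl x).
Proof.
rewrite /len; set y := (generic_quotient.repr (cl x) : P).
have /eqP/quotgP yx : cl y = cl x by rewrite /sofic_class reprK.
have [l yl] : exists l : R, (fun k => dHamm R (y k) 1) @ omega --> l.
  by apply: ultra_bounded_cvg => k; apply: dHamm1_bounds.
rewrite (cvg_lim (@norm_hausdorff _ _) yl).
have d0 : (fun k => dHamm R (x k) 1 - dHamm R (y k) 1)%R @ omega --> (0 : R)%R.
  apply/norm_cvg0P; apply: (squeeze_cvgr _ (cvg_cst 0%R) yx).
  apply: nearW => k; rewrite normr_ge0 /= ler_norml.
  have h1 := dHammM R (y k) ((y k)^-1 * x k).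
  have h2 := dHammM R (x k) ((x k)^-1 * y k).
  rewrite mulKVg in h1; rewrite mulKVg in h2.
  have h3 := dHammV R ((x k)^-1 * y k); rewrite invgM invgK in h3.
  have -> : (y^-1 * x) k = (y k)^-1 * x k by [].
  by apply/andP; split; lra.
have dl := ultra_add d0 yl; rewrite add0r in dl.
by apply: (ultra_ext _ (dl omegaU)) => k; rewrite subrK.
Qed.

Arguments len_cvg : clear implicits.

Lemma len_lim x (l : R) : (fun k => dHamm R (x k) 1) @ omega --> l -> len (cl x) = l.
Proof. by move=> xl; apply: ultra_unique (len_cvg x) xl. Qed.

Lemma len_ge0 a : (0 <= len a)%R.
Proof.
have [x ->] := cl_surj a; apply: (ultra_le (cvg_cst (0%R : R)) (len_cvg x)) => k.
exact: dHamm_ge0.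
Qed.

Lemma len_le1 a : (len a <= 1)%R.
Proof.
have [x ->] := cl_surj a; apply: (ultra_le (len_cvg x) (cvg_cst (1%R : R))) => k.
by have /andP[] := dHamm1_bounds (x k).
Qed.

Lemma lenM a b : (len (a * b) <= len a + len b)%R.
Proof.
have [x ->] := cl_surj a; have [y ->] := cl_surj b; rewrite -clM.
apply: (ultra_le (len_cvg _) (ultra_add (len_cvg x) (len_cvg y))) => k.
exact: dHammM.
Qed.

Lemma lenJ a b : len (a ^ b) = len a.
Proof.
have [x ->] := cl_surj a; have [y ->] := cl_surj b.
have -> : cl x ^ cl y = cl (x ^ y) by rewrite !conjgE !clM clV.
apply: len_lim; rewrite (_ : (fun k => _) = fun k => dHamm R (x k) 1).
  exact: len_cvg.
by apply/funext => k; exact: (dHammJ R (x k) (y k)).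
Qed.

(** If [len (i * u) = len i + len u] and likewise for [v], then [i] and [u * v]
    have disjoint supports, and this reads [len i + len (u * v) <= 1]. *)
Lemma len_almost_disjoint i u v :
  (len i + len (u * v) + (len (i * u) + len (i * v)) <=
   1 + ((len i + len u) + (len i + len v)))%R.
Proof.
have [x ->] := cl_surj i; have [y ->] := cl_surj u; have [z ->] := cl_surj v.
rewrite -!clM.
have sum2 x' y' : (fun k => dHamm R (x' k) 1 + dHamm R (y' k) 1)%R @ omega -->
    (len (cl x') + len (cl y'))%R by apply: ultra_add; apply: len_cvg.
apply: (ultra_le (ultra_add (sum2 x (y * z)) (sum2 (x * y) (x * z)))
  (ultra_add (cvg_cst (1%R : R)) (ultra_add (sum2 x y) (sum2 x z)))) => k /=.
exact: dHamm_almost_disjoint.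
Qed.

(** * Lengths of powers determine the conjugacy class *)

Hypothesis n_gt0 : forall k, (0 < n k)%N.

Lemma card_fixed_moved (T : finType) (s : {perm T}) :
  (#|[set t | s t == t]%SET| + #|moved s| = #|T|)%N.
Proof.
rewrite -(cardsC (moved s)) addnC; congr (_ + _)%N; apply: eq_card => t.
by rewrite !inE negbK.
Qed.

(** The difference of the proportions of points on cycles of length [m]. *)
Definition orbit_gap x y m k : R :=
  ((#|cycle_points (x k) m|%:R - #|cycle_points (y k) m|%:R) / (n k)%:R)%R.

(** The points fixed by the j-th power are those on cycles whose length divides
    [j]. *)
Lemma orbit_gap_sum x y j k : (0 < j)%N ->
  (\sum_(m < j.+1 | (m %| j)%N) orbit_gap x y m k =
   dHamm R (y k ^+ j) 1 - dHamm R (x k ^+ j) 1)%R.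
Proof.
move=> j0; rewrite /orbit_gap -mulr_suml sumrB -!natr_sum.
rewrite -!card_fixed_expg // !dHamm1E -mulrBl; congr (_ / _)%R.
have e := etrans (card_fixed_moved (x k ^+ j)) (esym (card_fixed_moved (y k ^+ j))).
by move/(congr1 (fun m => m%:R : R)%R): e; rewrite !natrD; lra.
Qed.

Lemma orbit_gap0 x y k : orbit_gap x y 0 k = 0%R.
Proof. by rewrite /orbit_gap !cycle_points0 subrr mul0r. Qed.

(** By strong induction on [m]: in the sum over the divisors of [m] all terms but
    the last one are known to tend to 0. *)
Lemma orbit_gap_cvg0 x y m :
  (forall j, len (cl x ^+ j) = len (cl y ^+ j)) ->
  orbit_gap x y m @ omega --> (0 : R)%R.
Proof.
move=> lenE; have [b] := ubnP m; elim: b m => // b IH m mb.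
have [->|m0] := posnP m.
  rewrite (_ : orbit_gap x y 0 = fun=> 0%R); first exact: cvg_cst.
  by apply/funext => k; apply: orbit_gap0.
have -> : orbit_gap x y m = (fun k =>
    (dHamm R ((y ^+ m) k) 1 - dHamm R ((x ^+ m) k) 1) +
    - \sum_(j <- index_enum 'I_m | (j %| m)%N) orbit_gap x y j k)%R.
  apply/funext => k; rewrite !prodg_expE -orbit_gap_sum //.
  rewrite big_mkcond big_ord_recr /=.
  by rewrite dvdnn -big_mkcond /= [RHS]addrC addKr.
have h1 : (fun k => dHamm R ((y ^+ m) k) 1 - dHamm R ((x ^+ m) k) 1)%R @ omega
    --> (0 : R)%R.
  have <- : (len (cl (y ^+ m)%g) - len (cl (x ^+ m)%g) = 0)%R.
    by rewrite !clX lenE subrr.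
  by apply: ultra_add; [|apply: cvgN]; apply: len_cvg.
have h2 : (fun k => \sum_(j <- index_enum 'I_m | (j %| m)%N) orbit_gap x y j k)%R
    @ omega --> (0 : R)%R.
  apply: (@cvg_sum0 R nat omega _ 'I_m (index_enum _) (fun j : 'I_m => (j %| m)%N)
    (fun j => orbit_gap x y j)) => j _ _; apply: IH.
  by have := ltn_ord j; lia.
by have := ultra_sub h1 h2; rewrite subr0; exact.
Qed.

Lemma card_moved_divg (T : finType) (p q : {perm T}) :
  #|moved (p^-1 * q)| = #|[set t | p t != q t]%SET|.
Proof.
rewrite -(card_imset _ (@perm_inj _ p^-1)); apply: eq_card => t.
rewrite -[t](permK p) mem_imset; last exact: perm_inj.
by rewrite !inE permM permK eq_sym.
Qed.

Lemma natr_distn (i j : nat) : ((i - j + (j - i))%:R = `|i%:R - j%:R| :> R)%R.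
Proof.
have [ij|ji] := leqP i j.
  rewrite (_ : i - j = 0)%N ?add0n; last by lia.
  by rewrite natrB // distrC ger0_norm // subr_ge0 ler_nat.
rewrite (_ : j - i = 0)%N ?addn0; last by lia.
by rewrite natrB ?(ltnW ji) // ger0_norm // subr_ge0 ler_nat ltnW.
Qed.

(** The conjugators given by [near_conjugate] leave an error of length at most
    [2 / M] for every [M], that is, none in the quotient. *)
Lemma conj_of_len a b : (forall j, len (a ^+ j) = len (b ^+ j)) ->
  exists g, b = a ^ g.
Proof.
have [x ->] := cl_surj a; have [y ->] := cl_surj b => lenE.
have [g hg] := dep_choice (fun k => near_conjugate (x k) (y k)).
pose z : P := (x ^ (g : P))^-1 * y.
exists (cl (g : P)).
have -> : cl x ^ cl (g : P) = cl (x ^ (g : P)) by rewrite !conjgE !clM clV.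
apply/esym/cl_eq.
suff : len (cl z) = 0%R by move=> <-; apply: len_cvg.
have key M : (0 < M)%N -> (len (cl z) <= 2 / M%:R)%R.
  move=> M0.
  have s0 : (fun k => \sum_(m <- index_enum 'I_M) `|orbit_gap x y m k|)%R
      @ omega --> (0 : R)%R.
    apply: (@cvg_sum0 R nat omega _ 'I_M (index_enum _) predT
    (fun m k => `|orbit_gap x y m k|%R)) => m _ _.
    rewrite -(normr0 R); apply: cvg_norm; exact: orbit_gap_cvg0.
  rewrite -[leRHS]add0r.
  apply: (ultra_le (len_cvg z) (ultra_add s0 (cvg_cst (2 / M%:R : R)%R))) => k.
  have -> : z k = (x k ^ g k)^-1 * y k by [].
  rewrite dHamm1E card_moved_divg.
  have := hg k M; rewrite card_ord -(ler_nat R) natrD !natrM natr_sum.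
  under eq_bigr do rewrite natr_distn.
  have -> : (\sum_(m < M) `|orbit_gap x y m k| =
     (\sum_(m < M) `|#|cycle_points (x k) m|%:R - #|cycle_points (y k) m|%:R|)
       / (n k)%:R)%R.
    rewrite mulr_suml; apply: eq_bigr => m _.
    by rewrite normrM normfV (ger0_norm (ler0n _ (n k))).
  move: (\sum_(m < M) _)%R (#|_|%:R)%R => s c h.
  have nk0 : (0 < (n k)%:R :> R)%R by rewrite ltr0n.
  have M0' : (0 < M%:R :> R)%R by rewrite ltr0n.
  rewrite ler_pdivrMr // mulrDl divfK ?lt0r_neq0 //.
  rewrite -(ler_pM2l M0') mulrDr; apply: le_trans h _.
  by rewrite lerD2l mulrA mulrCA divff ?mulr1 // lt0r_neq0.
apply/eqP; rewrite eq_le len_ge0 andbT; apply/ler_addgt0Pr => e e0.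
rewrite add0r; apply: le_trans (key (Num.truncn (2 / e)).+1 isT) _.
rewrite ler_pdivrMr ?ltr0n // mulrC -ler_pdivrMr //.
exact/ltW/truncnS_gt.
Qed.

(** * Involutions of prescribed lengths *)

Hypothesis omega_nonprincipal : forall k : nat, omega <> principal_filter k.
Hypothesis n_cvg : n @ \oo --> \oo.

Lemma degree_inv_cvg0 : (fun k => (n k)%:R^-1)%R @ omega --> (0 : R)%R.
Proof.
have n_omega : n @ omega --> \oo.
  by move=> A /n_cvg; apply: nonprincipal_sub_oo.
apply/cvgrPdist_le => e e0; move/cvgnyPge: n_omega => /(_ (Num.truncn e^-1).+1).
apply: filterS => k nk; rewrite sub0r normrN ger0_norm ?invr_ge0 ?ler0n //.
rewrite -[leRHS]invrK lef_pV2 ?posrE ?invr_gt0 ?ltr0n //.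
by apply: le_trans (ltW (truncnS_gt _)) _; rewrite ler_nat.
Qed.

Lemma ultra_squeeze_degree (u : nat -> R) (l c : R) :
  (forall k, l - c / (n k)%:R <= u k <= l)%R -> u @ omega --> l.
Proof.
move=> h; have c0 : (fun k => l - c * (n k)%:R^-1)%R @ omega --> (l - c * 0)%R.
  by apply: ultra_sub; [apply: cvg_cst | apply: cvgMr; exact: degree_inv_cvg0].
rewrite mulr0 subr0 in c0.
by apply: (squeeze_cvgr _ c0 (cvg_cst l)); apply: nearW.
Qed.

(** The number of blocks of four points that fill a proportion [r]. *)
Definition quarter (r : R) k := Num.truncn (r * (n k)%:R / 4)%R.

Lemma quarter_le r k : (0 <= r)%R -> ((4 * quarter r k)%N%:R <= r * (n k)%:R :> R)%R.
Proof.
move=> r0; have : ((quarter r k)%:R <= r * (n k)%:R / 4 :> R)%R.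
  by rewrite truncn_le divr_ge0 ?mulr_ge0 ?ler0n.
by rewrite natrM; lra.
Qed.

Lemma quarter_cvg r : (0 <= r)%R ->
  (fun k => (4 * quarter r k)%N%:R / (n k)%:R)%R @ omega --> r.
Proof.
move=> r0; apply: (@ultra_squeeze_degree _ r 4%R) => k.
have nk0 : (0 < (n k)%:R :> R)%R by rewrite ltr0n.
rewrite ler_pdivlMr // ler_pdivrMr // quarter_le // andbT mulrBl divfK ?lt0r_neq0 //.
have := truncnS_gt (r * (n k)%:R / 4)%R; rewrite -/(quarter r k).
by have := natr1 (quarter r k) : (_ = _ :> R)%R; rewrite natrM; lra.
Qed.

Lemma quarter_homo r s k : (r <= s)%R -> (quarter r k <= quarter s k)%N.
Proof.
move=> rs; apply: le_truncn; rewrite ler_pM2r ?invr_gt0 ?ltr0n //.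
by rewrite ler_wpM2r ?ler0n.
Qed.

(** The limit of [klein_triple]; monotonicity of the truncation keeps the four
    bounds in order. *)
Lemma exists_involution_pair (p q s z : R) :
  (0 <= p <= q)%R -> (q <= s <= z)%R -> (z <= 1)%R ->
  exists v w : G, [/\ v * v = 1, w * w = 1 & (v * w) * (v * w) = 1] /\
    [/\ len v = s, len w = z - p & len (v * w) = q + (z - s)]%R.
Proof.
move=> /andP[p0 pq] /andP[qs sz] z1.
have q0 := le_trans p0 pq; have s0 := le_trans q0 qs; have z0 := le_trans s0 sz.
have ex k : exists v w : 'S_(n k),
    [/\ v * v = 1, w * w = 1 & (v * w) * (v * w) = 1] /\
    [/\ #|moved v| = 4 * quarter s k,
        #|moved w| = 4 * (quarter z k - quarter p k) &
        #|moved (v * w)%g| =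
          4 * quarter q k + 4 * (quarter z k - quarter s k)]%N.
  apply: klein_triple; rewrite ?quarter_homo //.
  rewrite -(ler_nat R); apply: le_trans (quarter_le k z0) _.
  by rewrite ler_piMl ?ler0n.
have [v /dep_choice[w hvw]] := dep_choice ex.
exists (cl (v : P)), (cl (w : P)).
have density r r' k : (r' <= r)%R ->
    ((4 * (quarter r k - quarter r' k))%N%:R / (n k)%:R =
     (4 * quarter r k)%N%:R / (n k)%:R - (4 * quarter r' k)%N%:R / (n k)%:R :> R)%R.
  move=> rr; rewrite mulnBr natrB ?mulrBl //.
  by have := quarter_homo k rr; lia.
have zp : (p <= z)%R by lra.
rewrite -!clM; split.
  by split; apply: (cl_ext (y := 1)) => k; have [[]] := hvw k.
have [hp hq] := (quarter_cvg p0, quarter_cvg q0).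
have [hs hz] := (quarter_cvg s0, quarter_cvg z0).
split; apply: len_lim.
- by apply: (ultra_ext _ hs) => k; rewrite dHamm1E; have [_ [->]] := hvw k.
- apply: (ultra_ext _ (ultra_sub hz hp)) => k.
  by rewrite dHamm1E -density //; have [_ [_ -> _]] := hvw k.
- apply: (ultra_ext _ (ultra_add hq (ultra_sub hz hs))) => k.
  rewrite dHamm1E -density // -mulrDl -natrD.
  by have [_ [_ _ e]] := hvw k; rewrite -e.
Qed.

(** [i] fills the complement of the support of [a], up to one point in each
    coordinate, which is negligible since the degrees tend to infinity. *)
Lemma exists_disjoint_factorization a : exists i u v : G,
  [/\ a = u * v, [/\ i * i = 1, u * u = 1 & v * v = 1],
      (i * u) * (i * u) = 1 /\ (i * v) * (i * v) = 1,
      len (i * u) = (len i + len u)%R /\ len (i * v) = (len i + len v)%R &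
      len i = (1 - len a)%R].
Proof.
have [x ->] := cl_surj a.
have [i /dep_choice[u /dep_choice[v h]]] :=
  dep_choice (fun k => involution_decomposition (x k)).
have sumlen (y z : P) :
    (forall k, #|moved (y k * z k)| = (#|moved (y k)| + #|moved (z k)|)%N) ->
    len (cl y * cl z) = (len (cl y) + len (cl z))%R.
  move=> e; rewrite -clM; apply: len_lim.
  apply: (ultra_ext _ (ultra_add (len_cvg y) (len_cvg z))) => k.
  by rewrite !dHamm1E -mulrDl -natrD -e.
exists (cl (i : P)), (cl (u : P)), (cl (v : P)); split.
- by rewrite -clM; apply: cl_ext => k; have [] := h k.
- by rewrite -!clM; split; apply: (cl_ext (y := 1)) => k; have [_ []] := h k.
- by rewrite -!clM; split; apply: (cl_ext (y := 1)) => k; have [_ _ []] := h k.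
- by split; apply: sumlen => k; have [_ _ _ []] := h k.
suff : (fun k => dHamm R (i k) 1 + dHamm R (x k) 1)%R @ omega --> (1 : R)%R.
  move/(ultra_unique (ultra_add (len_cvg (i : P)) (len_cvg x))) => <-.
  by rewrite addrK.
apply: (@ultra_squeeze_degree _ 1%R 1%R) => k; have [_ _ _ _ ] := h k.
have nk0 : (0 < (n k)%:R :> R)%R by rewrite ltr0n.
rewrite !dHamm1E -mulrDl ler_pdivlMr // ler_pdivrMr // mulrBl divfK ?lt0r_neq0 //.
rewrite card_ord -!(ler_nat R) -!natr1 !natrD => /andP[h1 h2].
by apply/andP; split; lra.
Qed.

(** * Automorphisms preserve the length *)

Implicit Types (f h : G -> G).

(** The powers of an involution are itself and 1, so that its length alone
    determines its class. *)
Lemma conj_involution a b : a * a = 1 -> b * b = 1 -> len a = len b ->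
  exists g, b = a ^ g.
Proof.
move=> aa bb ab; apply: conj_of_len => // j.
have sq c : c * c = 1 -> c ^+ j = c ^+ (odd j).
  move=> cc; rewrite -{1}(odd_double_half j) expgD -mul2n expgM.
  by rewrite (expgS c 1) expg1 cc expg1n mulg1.
by rewrite (sq a) // (sq b) //; case: (odd j); rewrite ?expg1 ?expg0.
Qed.

Lemma morph_len_involution f a b : {morph f : x y / x * y} ->
  a * a = 1 -> b * b = 1 -> len a = len b -> len (f a) = len (f b).
Proof.
move=> fM aa bb ab; have [g ->] := conj_involution aa bb ab.
by rewrite morph_conj // lenJ.
Qed.

(** If [len a <= 2 * len b] then [a] is a product of two involutions of the length
    of [b]; otherwise split off from [a] an involution of that length and apply
    induction.  The case [N = 1] is excluded: [f] is not known to be monotone on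
    lengths, and a shorter involution may need two factors. *)
Lemma morph_len_scaling f N a b : {morph f : x y / x * y} -> (2 <= N)%N ->
  a * a = 1 -> b * b = 1 ->
  (len a <= N%:R * len b)%R -> (len (f a) <= N%:R * len (f b))%R.
Proof.
move=> fM; elim: N a => // N IH a N1 aa bb ab.
have b0 := len_ge0 b; have a0 := len_ge0 a.
have b1 := len_le1 b; have a1 := len_le1 a.
have fb0 := len_ge0 (f b).
have [ab2|ba2] := lerP (len a) (2 * len b)%R.
  suff h2 : (len (f a) <= 2 * len (f b))%R.
    by apply: le_trans h2 _; rewrite ler_wpM2r // ler_nat.
  have [v [w [[vv ww vwvw] [lv lw lvw]]]] : exists v w : G,
      [/\ v * v = 1, w * w = 1 & (v * w) * (v * w) = 1] /\
      [/\ len v = len b, len w = len b & len (v * w) = len a]%R.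
    (* If a is shorter than b, the factors agree outside the support of a;
       otherwise they overlap in a proportion 2 * len b - len a, where they
       carry different colours. *)
    have [h|h] := lerP (len a) (len b).
      have [||| v [w [e [l1 l2 l3]]]] :=
        @exists_involution_pair 0%R (len a) (len b) (len b).
      - by rewrite lexx a0.
      - by rewrite h lexx.
      - by [].
      - by exists v, w; split=> //; split; lra.
    have [||| v [w [e [l1 l2 l3]]]] :=
        @exists_involution_pair (len a - len b)%R (len b) (len b) (len a).
    - by apply/andP; split; lra.
    - by apply/andP; split; lra.
    - by [].
    - by exists v, w; split=> //; split; lra.
  rewrite -(morph_len_involution fM vwvw aa lvw) fM.
  apply: le_trans (lenM _ _) _.
  rewrite (morph_len_involution fM vv bb lv) (morph_len_involution fM ww bb lw).
  by lra.
(* If N + 1 = 2 this is the previous case. *)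
have N2 : (2 <= N)%N.
  rewrite ltnNge; apply/negP => N1'; have N2 : N = 1%N by lia.
  by move: ab; rewrite N2 leNgt ba2.
have [||| v [w [[vv ww vwvw] [lv lw lvw]]]] :=
        @exists_involution_pair (len b) (len b) (len b) (len a).
- by rewrite b0 lexx.
- by apply/andP; split; lra.
- by [].
have lvw' : len (v * w) = len a by rewrite lvw; lra.
rewrite -(morph_len_involution fM vwvw aa lvw') fM.
apply: le_trans (lenM _ _) _.
rewrite (morph_len_involution fM vv bb lv) -natr1 mulrDl mul1r addrC lerD2r.
apply: IH => //; rewrite lw; move: ab; rewrite -natr1; lra.
Qed.

(** Measure with an involution [t] of length [1 / M].  Scaling bounds [len (f a)]
    by about [M * len a] times [len (f t)]; scaling for the inverse [h] and
    an involution [e] of full length shows [len (f t) <= 1 / (M - 1)], as [e] is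
    longer than [M - 1] times [t]. *)
Lemma morph_len_involution_le f h a : {morph f : x y / x * y} ->
  {morph h : x y / x * y} -> cancel f h -> a * a = 1 -> (len (f a) <= len a)%R.
Proof.
move=> fM hM fK aa; have fsq b : b * b = 1 -> f b * f b = 1.
  by move=> bb; rewrite -fM bb (morph_one fM).
have a0 := len_ge0 a.
have key M : (3 <= M)%N -> (len (f a) * (M%:R - 1) <= len a * M%:R + 2)%R.
  move=> M3; have M0 : (3 <= M%:R :> R)%R by rewrite (ler_nat R 3).
  have iM : (0 <= (M%:R : R)^-1 <= 1)%R.
    by rewrite invr_ge0 ler0n /= invf_le1; lra.
  have /andP[iM0 iM1] := iM.
  have [||| t [e [[tt ee _] [lt le _]]]] :=
        @exists_involution_pair 0%R 0%R (M%:R^-1)%R 1%R.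
  - by rewrite lexx.
  - by rewrite iM.
  - by [].
  (* One more than the ceiling, so that 2 <= N. *)
  pose N := (Num.truncn (len a * M%:R)).+2.
  have N1 : (len a * M%:R <= N%:R)%R.
    apply: le_trans (ltW (truncnS_gt _)) _; rewrite ler_nat //.
  have N2 : (N%:R <= len a * M%:R + 2)%R.
    rewrite /N -addn2 natrD lerD2r truncn_le mulr_ge0 //; lra.
  have h2 : (len (f a) <= N%:R * len (f t))%R.
    apply: morph_len_scaling => //; rewrite lt ler_pdivlMr //; lra.
  have h3 : ((M%:R - 1) * len (f t) <= 1)%R.
    rewrite leNgt; apply/negP => h3.
    have : (len (h (f e)) <= M.-1%:R * len (h (f t)))%R.
      apply: morph_len_scaling; rewrite ?fsq //; first by lia.
      rewrite -subn1 natrB; last by lia.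
      by apply: le_trans (len_le1 _) (ltW h3).
    rewrite !fK le lt -subn1 natrB; last by lia.
    rewrite subr0 ler_pdivlMr; lra.
  have ft0 := len_ge0 (f t).
  apply: le_trans (ler_wpM2r _ h2) _; first by lra.
  rewrite -mulrA [X in (_ * X)%R]mulrC; apply: le_trans (ler_wpM2l _ h3) _ => //.
  by rewrite mulr1.
rewrite leNgt; apply/negP => lt.
pose d := (len (f a) - len a)%R; have d0 : (0 < d)%R by rewrite subr_gt0.
set K := Num.truncn (3 / d).
have hK : (3 < K.+1%:R * d)%R by rewrite -ltr_pdivrMr //; apply: truncnS_gt.
have e : (K.+3%:R = K.+1%:R + 2 :> R)%R by rewrite -[K.+3]addn2 natrD.
have := key K.+3 isT; rewrite e; move: (K.+1%:R)%R hK => m; rewrite /d.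
by have f1 := len_le1 (f a); nra.
Qed.

Lemma aut_len_involution f h a : {morph f : x y / x * y} ->
  {morph h : x y / x * y} -> cancel f h -> cancel h f ->
  a * a = 1 -> len (f a) = len a.
Proof.
move=> fM hM fK hK aa; apply/eqP; rewrite eq_le.
rewrite (morph_len_involution_le fM hM fK aa) /=.
rewrite -{1}(fK a); apply: (morph_len_involution_le hM fM hK).
by rewrite -fM aa (morph_one fM).
Qed.

(** The relations of [exists_disjoint_factorization] only involve lengths of
    involutions, so they hold for the images too, and the image of [i]
    bounds the support of the image of [a]. *)
Lemma aut_len_le f h a : {morph f : x y / x * y} ->
  {morph h : x y / x * y} -> cancel f h -> cancel h f -> (len (f a) <= len a)%R.
Proof.
move=> fM hM fK hK.
have [i [u [v [-> [ii uu vv] [iuu ivv] [liu liv] li]]]] :=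
  exists_disjoint_factorization a.
have flen b : b * b = 1 -> len (f b) = len b.
  exact: aut_len_involution fM hM fK hK.
have := len_almost_disjoint (f i) (f u) (f v).
rewrite -!fM (flen i) // (flen u) // (flen v) // (flen (i * u)) // (flen (i * v)) //.
by clear ii uu vv iuu ivv flen; lra.
Qed.

Lemma aut_len f h a : {morph f : x y / x * y} ->
  {morph h : x y / x * y} -> cancel f h -> cancel h f -> len (f a) = len a.
Proof.
move=> fM hM fK hK; apply/eqP; rewrite eq_le (aut_len_le _ fM hM fK hK) /=.
by rewrite -{1}(fK a) (aut_len_le _ hM fM hK fK).
Qed.

End UniversalSoficGroup.

Theorem theorem4p2 (R : realType) (omega : set_system nat)
    (omegaU : UltraFilter omega)
    (omega_nonprincipal : forall k : nat, omega <> principal_filter k)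
    (n : nat -> nat) (n_gt0 : forall k, (0 < n k)%N)
    (n_cvg : n @ \oo --> \oo)
    (Phi : {multiplicative universal_sofic R omega n -> universal_sofic R omega n})
    (Phi_bij : bijective Phi) (p : universal_sofic R omega n) :
  exists g : universal_sofic R omega n, Phi p = p ^ g.
Proof.
have [Psi PhiK PsiK] := Phi_bij.
have PhiM : {morph Phi : x y / x * y} := gmulfM.
have PsiM : {morph Psi : x y / x * y}.
  by move=> x y; apply: (can_inj PhiK); rewrite PhiM !PsiK.
apply: conj_of_len => // j.
have <- : Phi (p ^+ j) = Phi p ^+ j.
  elim: j => [|j IH]; last by rewrite !expgS PhiM IH.
  by rewrite !expg0 (morph_one PhiM).
by rewrite (aut_len n_gt0 omega_nonprincipal n_cvg _ PhiM PsiM PhiK PsiK).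
Qed.
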